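(* Let $\mathcal{H}$ be a reproducing kernel Hilbert space of complex-valued functions on a set $\Omega$ with kernel function $Q\colon\Omega\times\Omega\to\mathbb{C}$, and let $\Omega_0\subset\Omega$ be a subset. For a function $\varphi\colon\Omega_0\to\mathbb{C}$ let $\mathcal{K}_\varphi\subset\mathcal{H}\oplus\mathcal{H}$ be the closed linear span of the vectors $$\begin{pmatrix} Q(\,\cdot\,,z)\\ \varphi(z)\,Q(\,\cdot\,,z)\end{pmatrix},\qquad z\in\Omega_0 .$$ (i) Suppose $\varphi$ takes values in $\bar{D}=\{z\in\mathbb{C}:|z|\le 1\}$, and let $J=\begin{pmatrix} I & 0 \\ 0 & -I \end{pmatrix}$ on $\mathcal{H}\oplus\mathcal{H}$. Then $\langle k,Jk\rangle\ge 0$ for all $k\in\mathcal{K}_\varphi$ if and only if the function $$(z_1,z_2)\longmapsto\bigl(1-\overline{\varphi(z_1)}\varphi(z_2)\bigr)Q(z_1,z_2)$$ is positive definite on $\Omega_0$. (ii) Suppose instead $\varphi\colon\Omega_0\to\mathbb{C}$ is arbitrary, and let $J=\begin{pmatrix} 0 & I \\ I & 0 \end{pmatrix}$. Then $\langle k,Jk\rangle\ge 0$ for all $k\in\mathcal{K}_\varphi$ if and only if the function $$(z_1,z_2)\longmapsto\bigl(\overline{\varphi(z_1)}+\varphi(z_2)\bigr)Q(z_1,z_2)$$ is positive definite on $\Omega_0$.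
   Context: Inner products are conjugate-linear in the first variable and linear in the second. The kernel $Q$ satisfies $Q(\,\cdot\,,z)\in\mathcal{H}$ and $\langle Q(\,\cdot\,,z),h\rangle=h(z)$ for all $z\in\Omega$, $h\in\mathcal{H}$; hence $\langle Q(\,\cdot\,,z_1),Q(\,\cdot\,,z_2)\rangle=Q(z_1,z_2)$. A function $R\colon\Omega_0\times\Omega_0\to\mathbb{C}$ is called positive definite on $\Omega_0$ if $\sum_{i,j=1}^{n}\bar{c}_i c_j R(z_i,z_j)\ge 0$ for all $n$, all $z_1,\dots,z_n\in\Omega_0$ and all $c_1,\dots,c_n\in\mathbb{C}$. *)

(* Defs.v *)
From mathcomp Require Import all_boot all_order all_algebra sesquilinear.
From mathcomp Require Import all_classical all_reals all_analysis.
From mathcomp Require Export complex.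
Set Implicit Arguments.
Unset Strict Implicit.
Unset Printing Implicit Defensive.
Import Order.TTheory GRing.Theory Num.Theory.
Import numFieldNormedType.Exports.
Local Open Scope classical_set_scope.
Local Open Scope ring_scope.

Record hilbertSpace (R : realType) := HilbertSpace {
  hilbert_sort :> completeNormedModType R[i];
  hilbert_form : {dot hilbert_sort for Num.conj};
  hilbert_normE : forall u : hilbert_sort, `|u| ^+ 2 = hilbert_form u u }.

(* {dot _ for Num.conj} is linear in its first argument; swapping the arguments
   makes the inner product conjugate-linear in the first variable and linear in
   the second one. *)
Definition inner (R : realType) (H : hilbertSpace R) (u v : H) : R[i] :=
  hilbert_form H v u.

(* A Hilbert space of functions on Omega is a Hilbert space together with an
   injective linear map to Omega -> R[i] (with pointwise operations), through
   which its elements are regarded as functions.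
   The vector rkhs_section z is the function Q(., z). *)
Record rkhs (R : realType) (Omega : Type) := RKHS {
  rkhs_space :> hilbertSpace R;
  rkhs_fun : {linear rkhs_space -> (Omega -> R[i]^o)};
  rkhs_fun_inj : injective rkhs_fun;
  rkhs_section : Omega -> rkhs_space;
  rkhs_reproducing : forall (z : Omega) (h : rkhs_space),
    inner (rkhs_section z) h = rkhs_fun h z }.

Definition rkhs_kernel (R : realType) (Omega : Type) (H : rkhs R Omega)
    (w z : Omega) : R[i] :=
  rkhs_fun H (rkhs_section H z) w.

(* The order of R[i] is partial: 0 <= x means that x is real and nonnegative. *)
Definition positive_definite (R : realType) (X : Type) (K : X -> X -> R[i]) :=
  forall (n : nat) (z : 'I_n -> X) (c : 'I_n -> R[i]),
    0 <= \sum_(i < n) \sum_(j < n) (c i)^* * c j * K (z i) (z j).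

Definition linear_span (K : numFieldType) (V : lmodType K) (A : set V) : set V :=
  [set v | exists (n : nat) (c : 'I_n -> K) (a : 'I_n -> V),
     (forall i, A (a i)) /\ v = \sum_(i < n) c i *: a i].

Definition closed_linear_span (K : numFieldType) (V : normedModType K)
    (A : set V) : set V :=
  closure (linear_span A).

(* The direct sum of H with itself is the product H * H. The library norm of
   H * H is the maximum norm, which is equivalent to the norm given by
   dsum_inner, so that both define the same closed subspaces. *)
Definition dsum_inner (R : realType) (H : hilbertSpace R) (k l : H * H) : R[i] :=
  inner k.1 l.1 + inner k.2 l.2.

Definition block_op (R : realType) (H : hilbertSpace R) (A B C D : H -> H)
    (k : H * H) : H * H :=
  (A k.1 + B k.2, C k.1 + D k.2).

Definition J_diag (R : realType) (H : hilbertSpace R) : H * H -> H * H :=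
  block_op idfun \0 \0 -%R.

Definition J_swap (R : realType) (H : hilbertSpace R) : H * H -> H * H :=
  block_op \0 idfun idfun \0.

Definition K_space (R : realType) (Omega : Type) (H : rkhs R Omega)
    (Omega0 : set Omega) (phi : Omega0 -> R[i]) : set (H * H) :=
  closed_linear_span
    (range (fun z : Omega0 =>
       (rkhs_section H (val z), phi z *: rkhs_section H (val z)))).
Arguments K_space {R Omega} H {Omega0} phi.

(* Main.v *)
Require Import Defs.
From mathcomp Require Import all_boot all_order all_algebra sesquilinear.
From mathcomp Require Import all_classical all_reals all_analysis.
From mathcomp Require Import ring.
Import Order.TTheory GRing.Theory Num.Theory.
Import numFieldNormedType.Exports.
Local Open Scope classical_set_scope.
Local Open Scope ring_scope.

(** The quadratic form k |-> <k, Jk> evaluated at a finite combination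
    sum_i c_i (Q(., z_i), phi(z_i) Q(., z_i)) is the sum in the definition of
    positive definiteness of the given kernel, so positive definiteness says
    that the form is nonnegative on the linear span.  The form is a combination
    of squared norms (by polarization for the second J), hence continuous, and
    nonnegativity passes to the closure. *)

Lemma closed_nneg (K : numFieldType) : closed [set x : K | 0 <= x].
Proof.
(* [closed_ge] needs a total order; here [0 <= x] is the equation [`|x| = x] *)
have -> : [set x : K | 0 <= x] = (fun x : K => `|x| - x) @^-1` [set 0].
  by apply/seteqP; split=> x /=; rewrite ger0_def -subr_eq0 => /eqP.
apply: preimage_closed.
  move=> x _; apply: (@continuousB K K^o); last exact: cvg_id.
  exact: (@norm_continuous K K^o).
by apply: accessible_closed_set1; apply: hausdorff_accessible;
  exact: (@norm_hausdorff K K^o).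
Qed.

(** The set where the continuous [q] is nonnegative is closed, so it contains the closure of the
    span as soon as it contains the span. *)
Lemma closed_linear_span_nneg (K : numFieldType) (V : normedModType K)
    (X : Type) (f : X -> V) (q : V -> K) : continuous q ->
  (forall k, closed_linear_span (range f) k -> 0 <= q k) <->
  (forall n (z : 'I_n -> X) (c : 'I_n -> K),
     0 <= q (\sum_(i < n) c i *: f (z i))).
Proof.
move=> q_cont; split=> [q_ge0 n z c | q_ge0 k].
  apply: q_ge0; apply: subset_closure; exists n, c, (f \o z).
  by split=> // i; exists (z i).
(* The closure becomes the intersection of all closed supersets, and the preimage of the nonnegative
   numbers is one of them. *)
rewrite /closed_linear_span closureE.
move=> /(_ (q @^-1` [set x | 0 <= x])); apply; split.
  by apply: preimage_closed => [x _|]; [exact: q_cont|exact: closed_nneg].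
move=> _ [n [c [a [fa ->]]]].
have /choice[z za] : forall i, exists z, f z = a i.
  by move=> i; have [z _] := fa i; exists z.
under eq_bigr do rewrite -za.
exact: q_ge0.
Qed.

Lemma continuous_sqnorm (K : numFieldType) (V : normedModType K)
    (T : topologicalType) (f : T -> V) : continuous f ->
  continuous (fun x => `|f x| ^+ 2).
Proof. by move=> f_cont x; apply: cvgM; apply: cvg_norm; exact: f_cont. Qed.

Section Inner.
Variables (R : realType) (H : hilbertSpace R).
Implicit Types u v w : H.

(** [inner] swaps the arguments of [hilbert_form], so each rule for one variable comes from the
    library rule for the other. *)
Lemma innerDl u v w : inner (u + v) w = inner u w + inner v w.
Proof. exact: linearDr. Qed.

Lemma innerDr u v w : inner u (v + w) = inner u v + inner u w.
Proof. exact: linearDl. Qed.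

Lemma innerNr u v : inner u (- v) = - inner u v.
Proof. exact: linearNl. Qed.

Lemma innerZl a u v : inner (a *: u) v = a^* * inner u v.
Proof. exact: linearZr_LR. Qed.

Lemma innerZr a u v : inner u (a *: v) = a * inner u v.
Proof. exact: linearZl_LR. Qed.

Lemma inner_suml n (u : 'I_n -> H) v :
  inner (\sum_(i < n) u i) v = \sum_(i < n) inner (u i) v.
Proof. exact: linear_sumr. Qed.

Lemma inner_sumr n u (v : 'I_n -> H) :
  inner u (\sum_(i < n) v i) = \sum_(i < n) inner u (v i).
Proof. exact: linear_sumlz. Qed.

(** The families [c] and [d] are separate because the two components of a combination of [kvec]
    carry different coefficients. *)
Lemma inner_lincomb n (c d : 'I_n -> R[i]) (u v : 'I_n -> H) :
  inner (\sum_(i < n) c i *: u i) (\sum_(j < n) d j *: v j) =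
  \sum_(i < n) \sum_(j < n) (c i)^* * d j * inner (u i) (v j).
Proof.
rewrite inner_suml; apply: eq_bigr => i _.
rewrite inner_sumr; apply: eq_bigr => j _.
by rewrite innerZl innerZr mulrA.
Qed.

Lemma inner_norm u : inner u u = `|u| ^+ 2.
Proof. by rewrite hilbert_normE. Qed.

Lemma dsum_inner_diagE (k : H * H) :
  dsum_inner k (J_diag k) = `|k.1| ^+ 2 - `|k.2| ^+ 2.
Proof.
rewrite /dsum_inner /J_diag /block_op /= addr0 add0r.
by rewrite innerNr !inner_norm.
Qed.

(** Polarization: the cross terms of [|k.1 + k.2| ^+ 2] are exactly the form. Continuity of the norm
    then suffices for continuity of the form. *)
Lemma dsum_inner_swapE (k : H * H) :
  dsum_inner k (J_swap k) = `|k.1 + k.2| ^+ 2 - `|k.1| ^+ 2 - `|k.2| ^+ 2.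
Proof.
rewrite /dsum_inner /J_swap /block_op /= addr0 add0r -!inner_norm.
by rewrite innerDl !innerDr; ring.
Qed.

(** The cast gives the codomain the topology of a [numFieldType], as [closed_linear_span_nneg]
    expects. *)
Lemma continuous_dsum_inner_diag :
  continuous (fun k : H * H => dsum_inner k (J_diag k) : (R[i] : numFieldType)).
Proof.
under eq_fun do rewrite dsum_inner_diagE.
have fst_cont : continuous (@fst H H) by move=> k; exact: cvg_fst.
have snd_cont : continuous (@snd H H) by move=> k; exact: cvg_snd.
by move=> k; exact: cvgB (continuous_sqnorm _ _ _ _ fst_cont k)
  (continuous_sqnorm _ _ _ _ snd_cont k).
Qed.

Lemma continuous_dsum_inner_swap :
  continuous (fun k : H * H => dsum_inner k (J_swap k) : (R[i] : numFieldType)).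
Proof.
under eq_fun do rewrite dsum_inner_swapE.
have add_cont : continuous (fun k : H * H => k.1 + k.2)
  by exact: add_continuous.
have fst_cont : continuous (@fst H H) by move=> k; exact: cvg_fst.
have snd_cont : continuous (@snd H H) by move=> k; exact: cvg_snd.
by move=> k; exact: cvgB (cvgB (continuous_sqnorm _ _ _ _ add_cont k)
  (continuous_sqnorm _ _ _ _ fst_cont k)) (continuous_sqnorm _ _ _ _ snd_cont k).
Qed.

End Inner.

Section Kernel.
Variables (R : realType) (Omega : Type) (H : rkhs R Omega).
Variables (Omega0 : set Omega) (phi : Omega0 -> R[i]).

Let kvec (z : Omega0) : H * H :=
  (rkhs_section H (val z), phi z *: rkhs_section H (val z)).

Lemma inner_section (w z : Omega) :
  inner (rkhs_section H w) (rkhs_section H z) = rkhs_kernel H w z.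
Proof. exact: rkhs_reproducing. Qed.

(** Absorbing [phi] into the coefficients makes both components combinations of the same sections,
    ready for [inner_lincomb]. *)
Lemma lincomb_kvecE n (z : 'I_n -> Omega0) (c : 'I_n -> R[i]) :
  \sum_(i < n) c i *: kvec (z i) =
  (\sum_(i < n) c i *: rkhs_section H (val (z i)),
   \sum_(i < n) (c i * phi (z i)) *: rkhs_section H (val (z i))).
Proof.
rewrite [LHS]surjective_pairing; congr pair.
  by rewrite (raddf_sum fst).
rewrite (raddf_sum snd) /=.
by apply: eq_bigr => i _; rewrite scalerA.
Qed.

(** The first component yields the term 1 of the kernel factor; the second, with the sign from
    [J_diag], yields the product of values of [phi]. *)
Lemma dsum_inner_diag_lincomb n (z : 'I_n -> Omega0) (c : 'I_n -> R[i]) :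
  let k := \sum_(i < n) c i *: kvec (z i) in
  dsum_inner k (J_diag k) =
  \sum_(i < n) \sum_(j < n) (c i)^* * c j *
    ((1 - (phi (z i))^* * phi (z j)) * rkhs_kernel H (val (z i)) (val (z j))).
Proof.
rewrite /= dsum_inner_diagE lincomb_kvecE /= -!inner_norm !inner_lincomb -sumrB.
apply: eq_bigr => i _; rewrite -sumrB; apply: eq_bigr => j _.
rewrite inner_section rmorphM mulrBl mul1r mulrBr mulrA; congr (_ - _).
by rewrite !mulrA [_ * (phi _)^* * c j]mulrAC.
Qed.

Lemma dsum_inner_swap_lincomb n (z : 'I_n -> Omega0) (c : 'I_n -> R[i]) :
  let k := \sum_(i < n) c i *: kvec (z i) in
  dsum_inner k (J_swap k) =
  \sum_(i < n) \sum_(j < n) (c i)^* * c j *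
    (((phi (z i))^* + phi (z j)) * rkhs_kernel H (val (z i)) (val (z j))).
Proof.
(* [addrC] puts the pairing of [k.2] with [k.1] first: it produces the conjugated value of [phi],
   the other pairing the plain one. *)
rewrite /= /dsum_inner /J_swap /block_op /= addr0 add0r addrC lincomb_kvecE /=.
rewrite !inner_lincomb -big_split /=.
apply: eq_bigr => i _; rewrite -big_split /=; apply: eq_bigr => j _.
rewrite inner_section rmorphM mulrDl mulrDr !mulrA.
by rewrite [_ * (phi _)^* * c j]mulrAC.
Qed.

Lemma K_space_diag_nneg :
  (forall k : H * H, K_space H phi k -> 0 <= dsum_inner k (J_diag k)) <->
  positive_definite (fun z1 z2 : Omega0 =>
    (1 - (phi z1)^* * phi z2) * rkhs_kernel H (val z1) (val z2)).
Proof.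
(* [K_space H phi] unfolds to the closed linear span of the range of [kvec]. *)
rewrite (closed_linear_span_nneg _ _ _ kvec _ (continuous_dsum_inner_diag R H)).
by split=> nneg n z c; have := nneg n z c; rewrite dsum_inner_diag_lincomb.
Qed.

Lemma K_space_swap_nneg :
  (forall k : H * H, K_space H phi k -> 0 <= dsum_inner k (J_swap k)) <->
  positive_definite (fun z1 z2 : Omega0 =>
    ((phi z1)^* + phi z2) * rkhs_kernel H (val z1) (val z2)).
Proof.
rewrite (closed_linear_span_nneg _ _ _ kvec _ (continuous_dsum_inner_swap R H)).
by split=> nneg n z c; have := nneg n z c; rewrite dsum_inner_swap_lincomb.
Qed.

End Kernel.

Theorem proposition1p2 (R : realType) (Omega : Type) (H : rkhs R Omega)
    (Omega0 : set Omega) :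
  (forall phi : Omega0 -> R[i],
     (forall z : Omega0, `|phi z| <= 1) ->
     ((forall k : H * H, K_space H phi k -> 0 <= dsum_inner k (J_diag k))
      <->
      positive_definite (fun z1 z2 : Omega0 =>
        (1 - (phi z1)^* * phi z2) * rkhs_kernel H (val z1) (val z2)))) /\
  (forall phi : Omega0 -> R[i],
     ((forall k : H * H, K_space H phi k -> 0 <= dsum_inner k (J_swap k))
      <->
      positive_definite (fun z1 z2 : Omega0 =>
        ((phi z1)^* + phi z2) * rkhs_kernel H (val z1) (val z2)))).
Proof.
by split=> phi *; [exact: K_space_diag_nneg|exact: K_space_swap_nneg].
Qed.
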